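(* Let $n\ge 1$. Let $\mathcal S:M^n\to M^{2n}$, $\mathcal D:M^{2n}\to M^n$, $\mathcal Q:W^{2n}\to W^n$, $\mathcal R:W^n\to W^{2n}$ be smooth upscaling and downscaling rules acting on periodic sequences, and suppose that they have perfect reconstruction, i.e. $$\mathcal S\mathcal D c\ \oplus\ \mathcal R\mathcal Q\big(c\ominus \mathcal S\mathcal D c\big)=c\qquad\text{for all periodic data } c\in M^{2n}.$$ Then the mapping $c\mapsto c\ominus\mathcal S\mathcal D c$, from $M^{2n}$ to $W^{2n}$, has rank $n\cdot\dim M$ (which is half of $2n\cdot\dim M$, the generic rank of a mapping between these spaces).
   Context: $M$ is a finite-dimensional smooth manifold (a Lie group, or a manifold represented in a coordinate chart) and $W$ is a real vector space with $\dim W=\dim M$. The operations $\oplus$ (point plus vector is a point, $M\times W\to M$) and $\ominus$ (difference of points is a vector, $M\times M\to W$) are smooth on their domains and inverse to each other: $p\oplus(q\ominus p)=q$ and $(p\oplus v)\ominus p=v$. In a Lie group $G$ with Lie algebra $W=\mathfrak g$ one has $p\oplus v=p\exp(v)$ and $q\ominus p=\log(p^{-1}q)$; in a Riemannian manifold $p\oplus v=\exp_p(v)$ and $q\ominus p=\exp_p^{-1}(q)$, with tangent vectors represented in coordinates as elements of $W$. As these operations are in general defined only locally, all expressions are understood on open domains where the operations are defined, smooth, and mutually inverse. On sequences, $\oplus$ and $\ominus$ act elementwise. An $N$-periodic sequence in $M$ is identified with an element of $M^N$ (and similarly for $W$). Upscaling rules $\mathcal S,\mathcal R$ map $n$-periodic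 to $2n$-periodic sequences and downscaling rules $\mathcal D,\mathcal Q$ map $2n$-periodic to $n$-periodic ones. With the left shift $(Lc)_k=c_{k+1}$ they satisfy $\mathcal S L=L^2\mathcal S$, $\mathcal R L=L^2\mathcal R$, $\mathcal D L^2=L\mathcal D$, $\mathcal Q L^2=L\mathcal Q$. The detail coefficients of $c$ are $\mathcal Q(c\ominus\mathcal S\mathcal D c)$. The rank of a smooth mapping is the rank of its differential, at the points of its domain. *)

(* Defs.v *)
From HB Require Import structures.
From mathcomp Require Import all_boot all_order all_algebra.
From mathcomp Require Import all_classical all_reals all_analysis.

Set Implicit Arguments.
Unset Strict Implicit.
Unset Printing Implicit Defensive.

Import Order.TTheory GRing.Theory Num.Theory.
Import numFieldNormedType.Exports.

Local Open Scope classical_set_scope.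
Local Open Scope ring_scope.

Section Ck.
Context {R : realType} {V U : normedModType R}.

(* [g] is C^k on the open set [A].  For finite-dimensional [V] this recursion
   through the directional derivatives is the usual notion. *)
Fixpoint Ck_on (k : nat) (g : V -> U) (A : set V) : Prop :=
  match k with
  | 0 => forall x, A x -> {for x, continuous g}
  | k'.+1 => (forall x, A x -> differentiable g x) /\
             (forall v : V, Ck_on k' (fun x => 'D_v g x) A)
  end.

Definition smooth_on (g : V -> U) (A : set V) : Prop :=
  forall k, Ck_on k g A.

Definition smooth_near (g : V -> U) (x : V) : Prop :=
  exists2 O : set V, open_nbhs x O & smooth_on g O.

End Ck.

(* The values of [chart_map] outside [chart_dom], and of [chart_inv] outside
   the image of [chart_dom], are irrelevant. *)
Record chart (R : realType) (T : Type) (d : nat) := Chart {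
  chart_dom : set T;
  chart_map : T -> 'rV[R]_d;
  chart_inv : 'rV[R]_d -> T }.

Section ChartTheory.
Context {R : realType}.

Definition chart_img T d (phi : chart R T d) : set 'rV[R]_d :=
  chart_map phi @` chart_dom phi.

Definition is_homeo_chart (T : topologicalType) d (phi : chart R T d) : Prop :=
  [/\ open (chart_dom phi),
      open (chart_img phi),
      forall x, chart_dom phi x -> chart_inv phi (chart_map phi x) = x,
      forall x, chart_dom phi x -> {for x, continuous (chart_map phi)} &
      forall y, chart_img phi y -> {for y, continuous (chart_inv phi)}].

Definition smooth_transition T d (phi psi : chart R T d) : Prop :=
  smooth_on (chart_map psi \o chart_inv phi)
            (chart_map phi @` (chart_dom phi `&` chart_dom psi)).

Definition prod_chart T1 T2 d1 d2 (phi : chart R T1 d1) (psi : chart R T2 d2)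
    : chart R (T1 * T2) (d1 + d2) :=
  {| chart_dom := [set x | chart_dom phi x.1 /\ chart_dom psi x.2];
     chart_map := fun x => row_mx (chart_map phi x.1) (chart_map psi x.2);
     chart_inv := fun y => (chart_inv phi (lsubmx y), chart_inv psi (rsubmx y)) |}.

Definition seq_chart N T d (phi : 'I_N -> chart R T d)
    : chart R ('I_N -> T) (N * d) :=
  {| chart_dom := [set c | forall k, chart_dom (phi k) (c k)];
     chart_map := fun c => mxvec (\matrix_(k < N) chart_map (phi k) (c k));
     chart_inv := fun y k => chart_inv (phi k) (row k (vec_mx y)) |}.

(* Coordinates with respect to the basis [e] of [W]. *)
Definition vect_chart (W : vectType R) (e : (\dim {:W}).-tuple W)
    : chart R W (\dim {:W}) :=
  {| chart_dom := setT; chart_map := passmx.rVof e;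
     chart_inv := passmx.vecof e |}.

End ChartTheory.

(* Second countable Hausdorff smooth manifolds of dimension [d], without
   boundary. *)
Record smoothManifold (R : realType) (d : nat) := SmoothManifold {
  mfd_sort :> topologicalType;
  mfd_atlas : set (chart R mfd_sort d);
  mfd_hausdorff : hausdorff_space mfd_sort;
  mfd_second_countable : @second_countable mfd_sort;
  mfd_cover : forall x, exists2 phi, mfd_atlas phi & chart_dom phi x;
  mfd_homeo : forall phi, mfd_atlas phi -> is_homeo_chart phi;
  mfd_compat : forall phi psi,
    mfd_atlas phi -> mfd_atlas psi -> smooth_transition phi psi }.

Arguments mfd_atlas {R d} s.

Section Atlas.
Context {R : realType}.

Definition prod_atlas T1 T2 d1 d2 (a : set (chart R T1 d1))
    (b : set (chart R T2 d2)) : set (chart R (T1 * T2) (d1 + d2)) :=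
  [set chi | exists phi psi, [/\ a phi, b psi & chi = prod_chart phi psi]].

Definition seq_atlas N T d (a : set (chart R T d))
    : set (chart R ('I_N -> T) (N * d)) :=
  [set chi | exists2 phi : 'I_N -> chart R T d,
     (forall k, a (phi k)) & chi = seq_chart phi].

Definition vect_atlas (W : vectType R) : set (chart R W (\dim {:W})) :=
  [set chi | exists2 e : (\dim {:W}).-tuple W,
     basis_of {:W} e & chi = vect_chart e].

(* Openness in the topology induced by an atlas (see [manifold_openE]); used
   because products, sequence spaces and [W] carry an atlas only. *)
Definition atlas_open T d (a : set (chart R T d)) (A : set T) : Prop :=
  forall x phi, A x -> a phi -> chart_dom phi x ->
    \forall y \near chart_map phi x, A (chart_inv phi y).

Definition coord_rep T1 T2 d1 d2 (phi : chart R T1 d1) (psi : chart R T2 d2)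
    (f : T1 -> T2) : 'rV[R]_d1 -> 'rV[R]_d2 :=
  chart_map psi \o f \o chart_inv phi.

End Atlas.

Arguments seq_atlas {R} N {T d} a.
Arguments vect_atlas {R} W.

Lemma manifold_openE (R : realType) (d : nat) (M : smoothManifold R d)
  (A : set M) : atlas_open (mfd_atlas M) A <-> open A.
Proof.
split=> [oA|oA x phi Ax aphi phix].
  rewrite openE => x Ax.
  have [phi aphi phix] := mfd_cover x.
  have [oD _ phiK cphi _] := mfd_homeo aphi.
  have nA : nbhs x (chart_map phi @^-1` [set y | A (chart_inv phi y)]).
    exact: (cphi x phix _ (oA x phi Ax aphi phix)).
  have nD : nbhs x (chart_dom phi) by exact: open_nbhs_nbhs.
  apply: (@filterS _ (nbhs x) _ _ _ _ (filterI nA nD)) => z [/= + Dz].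
  by rewrite phiK.
have [_ _ phiK _ cinv] := mfd_homeo aphi.
have nA : nbhs (chart_inv phi (chart_map phi x)) A.
  by rewrite phiK //; exact: open_nbhs_nbhs.
by apply: (cinv (chart_map phi x) _ A nA); exists x.
Qed.

(* Partially defined maps; the values outside [pdom] are irrelevant. *)
Record partialMap (T U : Type) := PartialMap { pdom : set T; pfun :> T -> U }.

Arguments partialMap (T U)%_type.

Section PartialMaps.
Context {T U V : Type}.

Definition partial_id : partialMap T T := PartialMap setT id.

Definition partial_comp (g : partialMap U V) (f : partialMap T U)
    : partialMap T V :=
  PartialMap [set x | pdom f x /\ pdom g (f x)] (g \o f).

Definition partial_pair (f : partialMap T U) (g : partialMap T V)
    : partialMap T (U * V) :=
  PartialMap (pdom f `&` pdom g) (fun x => (f x, g x)).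

Definition elementwise N (op : partialMap (T * U) V)
    : partialMap (('I_N -> T) * ('I_N -> U)) ('I_N -> V) :=
  PartialMap [set c | forall k, pdom op (c.1 k, c.2 k)]
             (fun c k => op (c.1 k, c.2 k)).

End PartialMaps.

Arguments partial_id {T}.
Arguments elementwise {T U V N} op.

Section SmoothMaps.
Context {R : realType} {T1 T2 : Type} {d1 d2 : nat}.
Variables (a : set (chart R T1 d1)) (b : set (chart R T2 d2)).

(* The [\forall y \near _] clause makes the coordinate representation
   meaningful near the point; it expresses continuity of [f]. *)
Definition smooth_partial (f : partialMap T1 T2) : Prop :=
  atlas_open a (pdom f) /\
  forall x phi psi, pdom f x -> a phi -> b psi ->
    chart_dom phi x -> chart_dom psi (f x) ->
    (\forall y \near chart_map phi x, chart_dom psi (f (chart_inv phi y))) /\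
    smooth_near (coord_rep phi psi f) (chart_map phi x).

(* The rank of the differential of [f] at [x] is [r]. *)
Definition has_rank_at (f : T1 -> T2) (x : T1) (r : nat) : Prop :=
  forall phi psi, a phi -> b psi -> chart_dom phi x -> chart_dom psi (f x) ->
    differentiable (coord_rep phi psi f) (chart_map phi x) /\
    \rank ('J (coord_rep phi psi f) (chart_map phi x)) = r.

End SmoothMaps.

(* An [N]-periodic sequence is a map from ['I_N]; [ordS] is the cyclic
   successor. *)
Definition left_shift N T (c : 'I_N -> T) : 'I_N -> T := fun k => c (ordS k).

(* As for all identities between partially defined expressions, equality is
   required where both sides are defined. *)
Definition upscaling n T (f : partialMap ('I_n -> T) ('I_(2 * n) -> T)) : Prop :=
  forall c, pdom f (left_shift c) -> pdom f c ->
    f (left_shift c) = left_shift (left_shift (f c)).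

Definition downscaling n T (f : partialMap ('I_(2 * n) -> T) ('I_n -> T)) : Prop :=
  forall c, pdom f (left_shift (left_shift c)) -> pdom f c ->
    f (left_shift (left_shift c)) = left_shift (f c).

Section Operations.
Context {M W : Type}.
(* [oplus (p, v)] is the point [p] plus the vector [v], and [ominus (q, p)] is
   the vector [q] minus [p]. *)
Variables (oplus : partialMap (M * W) M) (ominus : partialMap (M * M) W).

Definition mutually_inverse : Prop :=
  (forall p q, pdom ominus (q, p) -> pdom oplus (p, ominus (q, p)) ->
     oplus (p, ominus (q, p)) = q) /\
  (forall p v, pdom oplus (p, v) -> pdom ominus (oplus (p, v), p) ->
     ominus (oplus (p, v), p) = v).

Variable n : nat.
Variables (ruleS : partialMap ('I_n -> M) ('I_(2 * n) -> M))
          (ruleD : partialMap ('I_(2 * n) -> M) ('I_n -> M))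
          (ruleQ : partialMap ('I_(2 * n) -> W) ('I_n -> W))
          (ruleR : partialMap ('I_n -> W) ('I_(2 * n) -> W)).

(* c |-> c (-) S D c *)
Definition prediction_error : partialMap ('I_(2 * n) -> M) ('I_(2 * n) -> W) :=
  partial_comp (elementwise ominus)
    (partial_pair partial_id (partial_comp ruleS ruleD)).

(* c |-> S D c (+) R Q (c (-) S D c) *)
Definition reconstruction : partialMap ('I_(2 * n) -> M) ('I_(2 * n) -> M) :=
  partial_comp (elementwise oplus)
    (partial_pair (partial_comp ruleS ruleD)
       (partial_comp ruleR (partial_comp ruleQ prediction_error))).

(* [U] is the domain of data under consideration: on it all expressions have to
   be defined.  For globally defined operations it can be [setT]. *)
Definition perfect_reconstruction_on (U : set ('I_(2 * n) -> M)) : Prop :=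
  forall c, U c -> pdom reconstruction c /\ reconstruction c = c.

End Operations.

(* Main.v *)
Require Import Defs.
From HB Require Import structures.
From mathcomp Require Import all_boot all_order all_algebra.
From mathcomp Require Import all_classical all_reals all_analysis.

Set Implicit Arguments.
Unset Strict Implicit.
Unset Printing Implicit Defensive.

Import Order.TTheory GRing.Theory Num.Theory.
Import numFieldNormedType.Exports.

Local Open Scope classical_set_scope.
Local Open Scope ring_scope.

(** Write [P] for [ruleS \o ruleD] and [F] for the prediction error, so that
    perfect reconstruction reads [oplus (P c, ruleR (ruleQ (F c))) = c].
    Subtracting [P c] and using that [ominus] undoes [oplus], one gets
    [ruleR (ruleQ (F c)) = F c], and hence also [oplus (P c, F c) = c]
    ([perfect_reconstruction_fixed]).  Both identities hold on an open set of
    data and can be differentiated.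

    The first one factors the differential of [F] through the space of
    [n]-periodic sequences in [W], so its rank is at most [n * m].

    The second one shows that a tangent vector killed by the differentials of
    both [P] and [F] vanishes; hence [2 * n * m] is at most the sum of the ranks
    of these differentials ([rank_add_ge]).  As [P] factors through
    [n]-periodic data in [M], its differential has rank at most [n * m], and
    at least [n * m] is left for [F].

    The rest is the calculus needed to differentiate in charts: the chain rule
    ([jacobian_in_comp]) and the differentiation of an operation applied
    elementwise to two sequences ([elementwise_jacobian_in]).  The latter is
    used twice: for the definition of [F], and for the identity
    [oplus (P c, F c) = c].  Jacobian matrices act on row vectors from the
    right, so those of composites multiply in the order in which the maps are
    applied. *)

(** * Jacobian matrices between spaces of row vectors *)

Section Jacobians.
Context {R : realType}.

Definition has_jacobian p q (f : 'rV[R]_p -> 'rV[R]_q) x (A : 'M[R]_(p, q)) :=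
  is_diff x f (fun v => v *m A).

Lemma has_jacobian_differentiable p q (f : 'rV[R]_p -> 'rV[R]_q) x A :
  has_jacobian f x A -> differentiable f x.
Proof. by case. Qed.

Lemma has_jacobian_near p q (f : 'rV[R]_p -> 'rV[R]_q) x A P :
  has_jacobian f x A -> (\forall z \near f x, P z) ->
  \forall y \near x, P (f y).
Proof.
by move=> /has_jacobian_differentiable/differentiable_continuous cf; exact: cf.
Qed.

Lemma has_jacobianE p q (f : 'rV[R]_p -> 'rV[R]_q) x A :
  has_jacobian f x A -> 'J f x = A.
Proof.
case=> _ dfE; apply/row_matrixP => i.
by rewrite !rowE /jacobian mul_rV_lin1 dfE.
Qed.

Lemma differentiable_has_jacobian p q (f : 'rV[R]_p -> 'rV[R]_q) x :
  differentiable f x -> has_jacobian f x ('J f x).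
Proof.
move=> df; apply: DiffDef => //.
by apply/funext => v; rewrite /jacobian mul_rV_lin1.
Qed.

(** A differential depends only on the germ of the map: the expansion of [f] at
    [x] is also one of [g], and [diff_unique] identifies the differentials. *)
Lemma has_jacobian_near_eq p q (f g : 'rV[R]_p -> 'rV[R]_q) x A :
  (\forall y \near x, f y = g y) -> has_jacobian f x A -> has_jacobian g x A.
Proof.
move=> fg [df dfE].
have fgx : f x = g x by exact: (nbhs_singleton fg).
have exp : g \o shift x = cst (g x) + 'd f x +o_ 0 id.
  have := diff_locally df => /eqaddoP fo; apply/eqaddoP => e e0.
  have fg0 : \forall h \near (0 : 'rV[R]_p), f (h + x) = g (h + x).
    by move: fg; rewrite (near_shift 0) subr0.
  near=> h.
  have : `|(f \o shift x - (cst (f x) + 'd f x)) h| <= e * `|id h|.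
    by near: h; exact: fo.
  have Eh : f (h + x) = g (h + x) by near: h.
  rewrite /= -[X in `|X| <= _ -> _]/(f (h + x) - (f x + 'd f x h)).
  by rewrite -[X in _ -> `|X| <= _]/(g (h + x) - (g x + 'd f x h)) Eh fgx.
have dgE : 'd g x = 'd f x :> (_ -> _).
  by apply: diff_unique => //; exact: diff_continuous.
apply: DiffDef; last by rewrite dgE.
apply/diff_locallyP; split; first by rewrite dgE; exact: diff_continuous.
by rewrite dgE.
Unshelve. all: by end_near. Qed.

Lemma has_jacobian_comp p q r (f : 'rV[R]_p -> 'rV[R]_q)
    (g : 'rV[R]_q -> 'rV[R]_r) x A B :
  has_jacobian f x A -> has_jacobian g (f x) B ->
  has_jacobian (g \o f) x (A *m B).
Proof.
move=> dfx dgx.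
rewrite /has_jacobian (_ : (fun v => _) = (fun v => v *m B) \o (fun v => v *m A)).
  exact: is_diff_comp.
by apply/funext => v /=; rewrite mulmxA.
Qed.

Lemma has_jacobian_mulmxr p q (A : 'M[R]_(p, q)) x :
  has_jacobian (fun v => v *m A) x A.
Proof.
have dA v : differentiable (fun v : 'rV[R]_p => v *m A) v.
  rewrite (_ : (fun v => _) = \sum_i (fun v : 'rV_p => v 0 i *: row i A)).
    apply: differentiable_sum => i.
    exact/differentiableZl/differentiable_coord.
  by apply/funext => u; rewrite fct_sumE mulmx_sum_row.
apply: DiffDef => //; apply: (@diff_lin _ _ _ (mulmxr A)) => v.
exact: differentiable_continuous (dA v).
Qed.

Lemma has_jacobian_mulr p q r (f : 'rV[R]_p -> 'rV[R]_q) x A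
    (B : 'M[R]_(q, r)) :
  has_jacobian f x A -> has_jacobian (fun y => f y *m B) x (A *m B).
Proof.
by move=> df; exact: has_jacobian_comp df (has_jacobian_mulmxr B (f x)).
Qed.

Lemma has_jacobianD p q (f g : 'rV[R]_p -> 'rV[R]_q) x A B :
  has_jacobian f x A -> has_jacobian g x B ->
  has_jacobian (fun y => f y + g y) x (A + B).
Proof.
move=> dfx dgx.
rewrite /has_jacobian -[fun y => _]/(f + g).
rewrite (_ : (fun v => _) = (fun v => v *m A) + (fun v => v *m B)).
  exact: is_diffD.
by apply/funext => v /=; rewrite mulmxDr.
Qed.

Lemma has_jacobian_row_mx p q r (f : 'rV[R]_p -> 'rV[R]_q)
    (g : 'rV[R]_p -> 'rV[R]_r) x A B :
  has_jacobian f x A -> has_jacobian g x B ->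
  has_jacobian (fun y => row_mx (f y) (g y)) x (row_mx A B).
Proof.
have row_mxE (k : nat) (a : 'M[R]_(k, q)) (b : 'M[R]_(k, r)) :
    row_mx a b = a *m row_mx 1%:M 0 + b *m row_mx 0 1%:M.
  by rewrite !mul_mx_row !mulmx1 !mulmx0 add_row_mx addr0 add0r.
move=> dfx dgx; rewrite row_mxE.
rewrite (_ : (fun y => _) =
    (fun y => f y *m row_mx 1%:M 0 + g y *m row_mx 0 1%:M)).
  by apply: has_jacobianD; exact: has_jacobian_mulr.
by apply/funext => y; rewrite row_mxE.
Qed.

(** Multiplication by [slot d k] on the right reads off the [k]-th block, of
    length [d], of the coordinate vector of a sequence in [seq_chart]. *)
Definition slot N d (k : 'I_N) : 'M[R]_(N * d, d) := lin1_mx (row k \o vec_mx).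

Lemma row_vec_mx N d (k : 'I_N) (y : 'rV[R]_(N * d)) :
  row k (vec_mx y) = y *m slot d k.
Proof. by rewrite mul_rV_lin1. Qed.

(** The blocks determine a vector; both a differential and a tangent vector can
    thus be studied one sequence element at a time. *)
Lemma slot_inj N d p (A B : 'M[R]_(p, N * d)) :
  (forall k, A *m slot d k = B *m slot d k) -> A = B.
Proof.
move=> AB; apply/row_matrixP => i.
rewrite -[LHS]vec_mxK -[RHS]vec_mxK; congr mxvec; apply/row_matrixP => k.
by rewrite !row_vec_mx -!row_mul AB.
Qed.

Lemma differentiable_slots p N d (f : 'rV[R]_p -> 'rV[R]_(N * d)) x :
  (forall k, differentiable (fun y => f y *m slot d k) x) -> differentiable f x.
Proof.
move=> df.
(* [put k] places a vector in the [k]-th block and zeros in the others. *)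
pose put (k : 'I_N) : 'M[R]_(d, N * d) :=
  lin1_mx (mxvec \o mulmx (delta_mx k 0 : 'cV[R]_N)).
rewrite (_ : f = \sum_k (fun y => f y *m slot d k *m put k)).
  apply: differentiable_sum => k.
  have /differentiable_has_jacobian dfk := df k.
  exact: has_jacobian_differentiable (has_jacobian_mulr (put k) dfk).
apply/funext => y; rewrite fct_sumE.
under eq_bigr do rewrite mul_rV_lin1 /= -row_vec_mx.
rewrite -linear_sum -[LHS]vec_mxK; congr mxvec.
apply/matrixP => i j; rewrite summxE (bigD1 i) //= big1 ?addr0 => [|k ki].
  by rewrite !mxE big_ord1 !mxE !eqxx mul1r.
by rewrite !mxE big_ord1 !mxE eq_sym (negPf ki) mul0r.
Qed.

End Jacobians.

(** * Jacobian matrices of maps read in charts *)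

Section JacobiansInCharts.
Context {R : realType}.

Definition inv_chartK T d (phi : chart R T d) :=
  forall x, chart_dom phi x -> chart_inv phi (chart_map phi x) = x.

(** The first clause makes the second one meaningful: without it,
    [coord_rep phi psi f] could involve values of [chart_map psi] outside
    [chart_dom psi], and the chain rule would fail. *)
Definition jacobian_in T1 T2 d1 d2 (phi : chart R T1 d1) (psi : chart R T2 d2)
    (f : T1 -> T2) (x : T1) (A : 'M[R]_(d1, d2)) : Prop :=
  (\forall y \near chart_map phi x, chart_dom psi (f (chart_inv phi y))) /\
  has_jacobian (coord_rep phi psi f) (chart_map phi x) A.

Lemma jacobian_in_unique T1 T2 d1 d2 (phi : chart R T1 d1)
    (psi : chart R T2 d2) (f : T1 -> T2) x A B :
  jacobian_in phi psi f x A -> jacobian_in phi psi f x B -> A = B.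
Proof. by move=> [_ /has_jacobianE <-] [_ /has_jacobianE <-]. Qed.

Lemma smooth_jacobian_in T1 T2 d1 d2 (a : set (chart R T1 d1))
    (b : set (chart R T2 d2)) (f : partialMap T1 T2) phi psi x :
  smooth_partial a b f -> pdom f x -> a phi -> b psi ->
  chart_dom phi x -> chart_dom psi (f x) ->
  exists A, jacobian_in phi psi f x A.
Proof.
move=> [_ sf] fx aphi bpsi phix psifx.
have [nf [Y [_ Yx] /(_ 1%N) [df _]]] := sf x phi psi fx aphi bpsi phix psifx.
by eexists; split=> //; exact/differentiable_has_jacobian/df.
Qed.

Lemma jacobian_in_near_eq T1 T2 d1 d2 (phi : chart R T1 d1)
    (psi : chart R T2 d2) (f g : T1 -> T2) x A :
  (\forall y \near chart_map phi x, f (chart_inv phi y) = g (chart_inv phi y)) ->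
  jacobian_in phi psi f x A -> jacobian_in phi psi g x A.
Proof.
move=> fg [nf df]; split; first by apply: filterS2 fg nf => y ->.
apply: has_jacobian_near_eq df; apply: filterS fg => y.
by rewrite /coord_rep /= => ->.
Qed.

(** Near [chart_map phi x] the intermediate chart cancels, so that the
    coordinate representation of the composite is the composite of the
    coordinate representations. *)
Lemma jacobian_in_comp T1 T2 T3 d1 d2 d3 (phi : chart R T1 d1)
    (psi : chart R T2 d2) (chi : chart R T3 d3) (f : T1 -> T2) (g : T2 -> T3)
    x A B :
  inv_chartK phi -> inv_chartK psi -> chart_dom phi x ->
  jacobian_in phi psi f x A -> jacobian_in psi chi g (f x) B ->
  jacobian_in phi chi (g \o f) x (A *m B).
Proof.
move=> phiK psiK phix [nf df] [ng dg].
have fx : coord_rep phi psi f (chart_map phi x) = chart_map psi (f x).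
  by rewrite /coord_rep /= phiK.
have cf : \forall y \near chart_map phi x,
    chart_dom chi (g (chart_inv psi (coord_rep phi psi f y))).
  apply: (has_jacobian_near (P := fun z => chart_dom chi (g (chart_inv psi z)))
    df).
  by rewrite fx.
split.
  by apply: filterS2 nf cf => y psify; rewrite /coord_rep /= psiK.
rewrite -fx in dg.
apply: has_jacobian_near_eq (has_jacobian_comp df dg).
by apply: filterS nf => y psify; rewrite /coord_rep /= psiK.
Qed.

Lemma jacobian_in_id T d (phi : chart R T d) x :
  (\forall y \near chart_map phi x, chart_dom phi (chart_inv phi y) /\
     chart_map phi (chart_inv phi y) = y) ->
  jacobian_in phi phi id x 1%:M.
Proof.
move=> near_phi; split; first by apply: filterS near_phi => y [].
apply: (@has_jacobian_near_eq _ _ _ (fun y => y *m 1%:M)).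
  by apply: filterS near_phi => y [_ phiK]; rewrite mulmx1 /coord_rep /= phiK.
exact: has_jacobian_mulmxr.
Qed.

Lemma seq_chart_slot N T d (phi : 'I_N -> chart R T d) c k :
  chart_map (seq_chart phi) c *m slot d k = chart_map (phi k) (c k).
Proof. by rewrite -row_vec_mx mxvecK rowK. Qed.

Lemma seq_inv_chartK N T d (phi : 'I_N -> chart R T d) :
  (forall k, inv_chartK (phi k)) -> inv_chartK (seq_chart phi).
Proof.
move=> phiK c phic; apply/funext => k /=.
by rewrite mxvecK rowK phiK.
Qed.

(** Coordinates in which each block lies in the open image of the corresponding
    chart are coordinates of a sequence in the domain. *)
Lemma seq_chart_near N (T : topologicalType) d (phi : 'I_N -> chart R T d) c :
  (forall k, is_homeo_chart (phi k)) -> chart_dom (seq_chart phi) c ->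
  \forall y \near chart_map (seq_chart phi) c,
    chart_dom (seq_chart phi) (chart_inv (seq_chart phi) y) /\
    chart_map (seq_chart phi) (chart_inv (seq_chart phi) y) = y.
Proof.
move=> hphi phic.
have img k : \forall y \near chart_map (seq_chart phi) c,
    chart_img (phi k) (y *m slot d k).
  have [_ oimg _ _ _] := hphi k.
  apply: (has_jacobian_near (has_jacobian_mulmxr (slot d k) _)).
  rewrite seq_chart_slot; apply: open_nbhs_nbhs; split=> //.
  by exists (c k); first exact: phic.
apply: filterS (filter_forall _ img) => y yimg.
have phiK k z : chart_dom (phi k) z -> chart_inv (phi k) (chart_map (phi k) z) = z.
  by have [_ _ + _ _] := hphi k; apply.
split=> [k|].
  by have [z zk /= zE] := yimg k; rewrite /= row_vec_mx -zE phiK.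
apply: slot_inj => k; rewrite seq_chart_slot /= row_vec_mx.
by have [z zk <-] := yimg k; rewrite phiK.
Qed.

(** In charts, the [k]-th block of [op (f c k, g c k)] is [op] applied to the
    pair of the [k]-th blocks of [f] and [g], whence the chain rule for each
    block.  By [slot_inj], the equations for the blocks determine [D]. *)
Lemma elementwise_jacobian_in N X T U V dX dT dU dV (phi : chart R X dX)
    (chi : 'I_N -> chart R T dT) (psi : 'I_N -> chart R U dU)
    (om : 'I_N -> chart R V dV) (f : X -> 'I_N -> T) (g : X -> 'I_N -> U)
    (op : T * U -> V) x A B C :
  inv_chartK phi -> (forall k, inv_chartK (chi k)) ->
  (forall k, inv_chartK (psi k)) -> chart_dom phi x ->
  jacobian_in phi (seq_chart chi) f x A ->
  jacobian_in phi (seq_chart psi) g x B ->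
  (forall k, jacobian_in (prod_chart (chi k) (psi k)) (om k) op
     (f x k, g x k) (C k)) ->
  exists2 D, jacobian_in phi (seq_chart om) (fun c k => op (f c k, g c k)) x D &
    forall k, D *m slot dV k =
      row_mx (A *m slot dT k) (B *m slot dU k) *m C k.
Proof.
move=> phiK chiK psiK phix [nf df] [ng dg] dop.
pose args k y := row_mx (coord_rep phi (seq_chart chi) f y *m slot dT k)
                        (coord_rep phi (seq_chart psi) g y *m slot dU k).
have argsE k y : args k y = chart_map (prod_chart (chi k) (psi k))
    (f (chart_inv phi y) k, g (chart_inv phi y) k).
  by rewrite /args /coord_rep /= !seq_chart_slot.
have argsK k : \forall y \near chart_map phi x,
    chart_inv (prod_chart (chi k) (psi k)) (args k y) =
    (f (chart_inv phi y) k, g (chart_inv phi y) k).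
  apply: filterS2 nf ng => y fy gy.
  by rewrite argsE /= row_mxKl row_mxKr chiK ?psiK.
have dargs k : has_jacobian (args k) (chart_map phi x)
    (row_mx (A *m slot dT k) (B *m slot dU k)).
  by apply: has_jacobian_row_mx; exact: has_jacobian_mulr.
have args_x k : args k (chart_map phi x) =
    chart_map (prod_chart (chi k) (psi k)) (f x k, g x k).
  by rewrite argsE phiK.
set h := fun c k => op (f c k, g c k).
have dh k : has_jacobian
    (fun y => coord_rep phi (seq_chart om) h y *m slot dV k) (chart_map phi x)
    (row_mx (A *m slot dT k) (B *m slot dU k) *m C k).
  have [_ dopk] := dop k.
  rewrite -args_x in dopk.
  apply: has_jacobian_near_eq (has_jacobian_comp (dargs k) dopk).
  apply: filterS (argsK k) => y argsKy.
  rewrite -[LHS]/(chart_map (om k) (op (chart_inv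
    (prod_chart (chi k) (psi k)) (args k y)))) argsKy.
  by rewrite /coord_rep /= seq_chart_slot.
have dhx : differentiable (coord_rep phi (seq_chart om) h) (chart_map phi x).
  by apply: differentiable_slots => k; exact: has_jacobian_differentiable (dh k).
have {}dhx := differentiable_has_jacobian dhx.
eexists; last first.
  move=> k; rewrite -(has_jacobianE (dh k)); symmetry.
  exact: has_jacobianE (has_jacobian_mulr (slot dV k) dhx).
split=> //.
have nom k : \forall y \near chart_map phi x,
    chart_dom (om k) (h (chart_inv phi y) k).
  have [nop _] := dop k.
  have nk : \forall y \near chart_map phi x, chart_dom (om k)
      (op (chart_inv (prod_chart (chi k) (psi k)) (args k y))).
    apply: (has_jacobian_near (P := fun z => chart_dom (om k)
      (op (chart_inv (prod_chart (chi k) (psi k)) z))) (dargs k)).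
    by rewrite args_x.
  by apply: filterS2 nk (argsK k) => y + argsKy; rewrite argsKy.
exact: filterS (filter_forall _ nom).
Qed.

End JacobiansInCharts.

(** * Perfect reconstruction *)

(** With [v = ruleR (ruleQ (F c))], perfect reconstruction says that
    [oplus (P c k, v k)] is [c k].  The difference of [c k] and [P c k] is by
    definition [F c k], and it is [v k] since [ominus] undoes [oplus]. *)
Lemma perfect_reconstruction_fixed M W n (oplus : partialMap (M * W) M)
    (ominus : partialMap (M * M) W) (op_inverse : mutually_inverse oplus ominus)
    (ruleS : partialMap ('I_n -> M) ('I_(2 * n) -> M))
    (ruleD : partialMap ('I_(2 * n) -> M) ('I_n -> M))
    (ruleQ : partialMap ('I_(2 * n) -> W) ('I_n -> W))
    (ruleR : partialMap ('I_n -> W) ('I_(2 * n) -> W))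
    (P := partial_comp ruleS ruleD)
    (F := prediction_error ominus ruleS ruleD) c :
  pdom (reconstruction oplus ominus ruleS ruleD ruleQ ruleR) c ->
  reconstruction oplus ominus ruleS ruleD ruleQ ruleR c = c ->
  [/\ pdom P c, forall k, pdom ominus (c k, P c k),
      pdom ruleQ (F c) /\ pdom ruleR (ruleQ (F c)),
      ruleR (ruleQ (F c)) = F c &
      forall k, pdom oplus (P c k, F c k) /\ oplus (P c k, F c k) = c k].
Proof.
move=> [[Pc [[[_ mc] Qc] Rc]] pc] rec_c.
have rec_k k : oplus (P c k, ruleR (ruleQ (F c)) k) = c k.
  exact (congr1 (fun b : 'I_(2 * n) -> M => b k) rec_c).
have RQF : ruleR (ruleQ (F c)) = F c.
  apply/funext => k; have := op_inverse.2 _ _ (pc k); rewrite /= rec_k.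
  by move=> <- //; exact: mc.
by split=> // k; rewrite -RQF; split; [exact: pc|exact: rec_k].
Qed.

(** The hypothesis says that [row_mx A B] has a trivial row kernel, hence
    rank [p]; and the rank of a block matrix is subadditive. *)
Lemma rank_add_ge (K : fieldType) p r s (A : 'M[K]_(p, r))
    (B : 'M[K]_(p, s)) :
  (forall v : 'rV_p, v *m A = 0 -> v *m B = 0 -> v = 0) ->
  (p <= \rank A + \rank B)%N.
Proof.
move=> AB0.
have : row_free (row_mx A B).
  rewrite -kermx_eq0; apply/eqP/row_matrixP => i; rewrite row0.
  have : row i (kermx (row_mx A B)) *m row_mx A B = 0.
    by rewrite -row_mul mulmx_ker row0.
  rewrite mul_mx_row -[RHS]row_mx0 => /eq_row_mx [vA vB]; exact: AB0.
move=> /eqP rkAB; apply: (@leq_trans (\rank (row_mx A B))).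
  by rewrite rkAB.
rewrite -mxrank_tr tr_row_mx -addsmxE -(mxrank_tr A) -(mxrank_tr B).
exact: mxrank_adds_leqif.
Qed.

Lemma vect_inv_chartK (R : realType) (W : vectType R)
    (e : (\dim {:W}).-tuple W) :
  basis_of {:W} e -> inv_chartK (vect_chart e).
Proof. by move=> be x _; exact: passmx.rVofK. Qed.

Theorem mainTheorem1 (R : realType) (m : nat) (M : smoothManifold R m)
  (W : vectType R) (dimW : \dim {:W} = m)
  (oplus : partialMap (M * W) M) (ominus : partialMap (M * M) W)
  (oplus_smooth : smooth_partial
    (prod_atlas (mfd_atlas M) (vect_atlas W)) (mfd_atlas M) oplus)
  (ominus_smooth : smooth_partial
    (prod_atlas (mfd_atlas M) (mfd_atlas M)) (vect_atlas W) ominus)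
  (op_inverse : mutually_inverse oplus ominus)
  (n : nat) (n_ge1 : (1 <= n)%N)
  (ruleS : partialMap ('I_n -> M) ('I_(2 * n) -> M))
  (ruleD : partialMap ('I_(2 * n) -> M) ('I_n -> M))
  (ruleQ : partialMap ('I_(2 * n) -> W) ('I_n -> W))
  (ruleR : partialMap ('I_n -> W) ('I_(2 * n) -> W))
  (S_smooth : smooth_partial
    (seq_atlas n (mfd_atlas M)) (seq_atlas (2 * n) (mfd_atlas M)) ruleS)
  (D_smooth : smooth_partial
    (seq_atlas (2 * n) (mfd_atlas M)) (seq_atlas n (mfd_atlas M)) ruleD)
  (Q_smooth : smooth_partial
    (seq_atlas (2 * n) (vect_atlas W)) (seq_atlas n (vect_atlas W)) ruleQ)
  (R_smooth : smooth_partial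
    (seq_atlas n (vect_atlas W)) (seq_atlas (2 * n) (vect_atlas W)) ruleR)
  (S_up : upscaling ruleS) (D_down : downscaling ruleD)
  (Q_down : downscaling ruleQ) (R_up : upscaling ruleR)
  (U : set ('I_(2 * n) -> M))
  (U_open : atlas_open (seq_atlas (2 * n) (mfd_atlas M)) U)
  (PR : perfect_reconstruction_on oplus ominus ruleS ruleD ruleQ ruleR U) :
  forall c, U c ->
    has_rank_at
      (seq_atlas (2 * n) (mfd_atlas M)) (seq_atlas (2 * n) (vect_atlas W))
      (prediction_error ominus ruleS ruleD) c (n * m).
Proof.
move=> c Uc Phi Psi aPhi aPsi; have := aPsi; have := aPhi.
move=> [phi aphi PhiE] [psi apsi PsiE] Phic Psic; subst Phi Psi.
set P := partial_comp ruleS ruleD.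
set F := prediction_error ominus ruleS ruleD.
pose fixedU b (Ub : U b) :=
  perfect_reconstruction_fixed op_inverse (PR b Ub).1 (PR b Ub).2.
have [[Dc SDc] mc [Qc Rc] RQF pc] := fixedU c Uc.
have near_U : \forall y \near chart_map (seq_chart phi) c,
    U (chart_inv (seq_chart phi) y) := U_open c _ Uc aPhi Phic.
have mfdK (chi : chart R M m) : mfd_atlas M chi -> inv_chartK chi.
  by move=> achi; have [_ _ + _ _] := mfd_homeo achi; apply.
have vectK (chi : chart R W _) : vect_atlas W chi -> inv_chartK chi.
  by move=> [e be ->]; exact: vect_inv_chartK.
have vect_dom (chi : chart R W _) w : vect_atlas W chi -> chart_dom chi w.
  by move=> [e be ->].
have mfd_chart N (b : 'I_N -> M) : exists2 chi : 'I_N -> chart R M m,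
    forall k, mfd_atlas M (chi k) & chart_dom (seq_chart chi) b.
  have /choice[chi chiP] k : exists chi : chart R M m,
      mfd_atlas M chi /\ chart_dom chi (b k).
    by have [chi] := mfd_cover (b k); exists chi.
  by exists chi => k; have [] := chiP k.
(* Charts at the intermediate values: [delta] at [ruleD c], [sigma] at [P c],
   [xi] at [ruleQ (F c)]. *)
have [delta adelta deltac] := mfd_chart _ (ruleD c).
have [sigma asigma sigmac] := mfd_chart _ (P c).
pose xi (k : 'I_n) : chart R W _ := vect_chart (vbasis {:W}).
have axi k : vect_atlas W (xi k) by exists (vbasis {:W}) => //; exact: vbasisP.
have PhiK : inv_chartK (seq_chart phi).
  by apply: seq_inv_chartK => k; exact: mfdK.
have PsiK : inv_chartK (seq_chart psi).
  by apply: seq_inv_chartK => k; exact: vectK.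
have [JD dD] : exists A, jacobian_in (seq_chart phi) (seq_chart delta) ruleD c A.
  apply: smooth_jacobian_in D_smooth _ _ _ _ _ => //.
  by exists delta.
have [JS dS] : exists A,
    jacobian_in (seq_chart delta) (seq_chart sigma) ruleS (ruleD c) A.
  apply: smooth_jacobian_in S_smooth _ _ _ _ _ => //.
  - by exists delta.
  - by exists sigma.
have dP : jacobian_in (seq_chart phi) (seq_chart sigma) P c (JD *m JS).
  apply: jacobian_in_comp dD dS => //.
  by apply: seq_inv_chartK => k; exact: mfdK.
have did : jacobian_in (seq_chart phi) (seq_chart phi) id c 1%:M.
  apply/jacobian_in_id/seq_chart_near => // k; exact: mfd_homeo.
have /choice[Jm dm] k : exists A, jacobian_in (prod_chart (phi k) (sigma k))
    (psi k) ominus (c k, P c k) A.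
  apply: smooth_jacobian_in ominus_smooth _ _ _ _ _ => //.
  by exists (phi k), (sigma k).
(* [F c] is the elementwise difference of [c] and [P c]. *)
have [JF dF _] := elementwise_jacobian_in PhiK (fun k => mfdK _ (aphi k))
  (fun k => mfdK _ (asigma k)) Phic did dP dm.
have [JQ dQ] : exists A, jacobian_in (seq_chart psi) (seq_chart xi) ruleQ (F c) A.
  apply: smooth_jacobian_in Q_smooth _ _ _ _ _ => //.
  by exists xi.
have [JR dR] : exists A,
    jacobian_in (seq_chart xi) (seq_chart psi) ruleR (ruleQ (F c)) A.
  apply: smooth_jacobian_in R_smooth _ _ _ _ _ => //.
  - by exists xi.
  - by move=> k; exact: vect_dom.
have dQF : jacobian_in (seq_chart phi) (seq_chart xi) (ruleQ \o F) c (JF *m JQ).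
  exact: (jacobian_in_comp PhiK PsiK Phic dF dQ).
have xiK : inv_chartK (seq_chart xi).
  by apply: seq_inv_chartK => k; exact: vectK.
have dRQF : jacobian_in (seq_chart phi) (seq_chart psi)
    (ruleR \o (ruleQ \o F)) c (JF *m JQ *m JR).
  exact: (jacobian_in_comp PhiK xiK Phic dQF dR).
have JFE : JF = JF *m JQ *m JR.
  apply: jacobian_in_unique dF _; apply: jacobian_in_near_eq dRQF.
  by apply: filterS near_U => y /fixedU [_ _ _ + _].
(* [J1] is the Jacobian of the elementwise sum of [P] and [F], which is the
   identity near [c]. *)
have /choice[Jp dp] k : exists A, jacobian_in (prod_chart (sigma k) (psi k))
    (phi k) oplus (P c k, F c k) A.
  apply: smooth_jacobian_in oplus_smooth _ _ _ _ _ => //.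
  - by have [] := pc k.
  - by exists (sigma k), (psi k).
  - by have [_ ->] := pc k.
have [J1 dPF J1E] := elementwise_jacobian_in PhiK (fun k => mfdK _ (asigma k))
  (fun k => vectK _ (apsi k)) Phic dP dF dp.
have J1_1 : J1 = 1%:M.
  apply: jacobian_in_unique did; apply: jacobian_in_near_eq dPF.
  apply: filterS near_U => y /fixedU [_ _ _ _ pcy].
  by apply/funext => k; have [] := pcy k.
have [_ dF'] := dF.
split; first exact: has_jacobian_differentiable dF'.
rewrite (has_jacobianE dF'); apply/eqP; rewrite eqn_leq; apply/andP; split.
  rewrite JFE (leq_trans (mxrankM_maxl _ _)) // (leq_trans (rank_leq_col _)) //.
  by rewrite dimW.
have : (2 * n * m <= \rank (JD *m JS) + \rank JF)%N.
  apply: rank_add_ge => v vP vF; apply: slot_inj => k.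
  rewrite mul0mx -[v]mulmx1 -J1_1 -mulmxA J1E mulmxA mul_mx_row.
  by rewrite (mulmxA v (JD *m JS)) (mulmxA v JF) vP vF !mul0mx row_mx0 mul0mx.
have : (\rank (JD *m JS) <= n * m)%N.
  by rewrite (leq_trans (mxrankM_maxl _ _)) // rank_leq_col.
move=> rkP rk; rewrite -(leq_add2l (n * m)) addnn -mul2n (mulnA 2).
by rewrite (leq_trans rk) // leq_add2r.
Qed.
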